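(* The holomorphic sectional curvature of $({\rm M}_1,\gamma)$ is unbounded above.
   Context: ${\rm M}_1$ is the space of degree one rational maps $W(z)=\frac{az+b}{cz+d}$, $ad-bc\neq0$, of the Riemann sphere, with complex structure $J$ induced by the open inclusion ${\rm M}_1\subset\mathbb{C}P^3$, $W\mapsto[a:b:c:d]$. $\gamma$ is the $L^2$ metric: for a tangent vector represented by a variation $\dot W$, $\gamma(\dot W,\dot W)=\int_{\mathbb{C}}\frac{2\,dx\,dy}{(1+|z|^2)^2}\frac{|\dot W|^2}{(1+|W|^2)^2}$ ($z=x+iy$; stereographic coordinates on both spheres); $\gamma$ is K\''ahler with respect to $J$. The holomorphic sectional curvature of a unit vector $X$ is ${\rm Hol}(X)=\langle R(X,JX)JX,X\rangle$, $R$ the Riemann curvature tensor of $\gamma$. *)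

(* Defs.v *)
From HB Require Import structures.
From mathcomp Require Import all_boot all_order all_algebra.
From mathcomp Require Import all_classical all_reals all_analysis.
Set Implicit Arguments. Unset Strict Implicit. Unset Printing Implicit Defensive.
Import Order.TTheory GRing.Theory Num.Theory.
Import numFieldNormedType.Exports.
Local Open Scope ring_scope.

Section Cplx.
Variable R : realType.
Definition cadd (z w : R * R) : R * R := (z.1 + w.1, z.2 + w.2).
Definition csub (z w : R * R) : R * R := (z.1 - w.1, z.2 - w.2).
Definition cmul (z w : R * R) : R * R :=
  (z.1 * w.1 - z.2 * w.2, z.1 * w.2 + z.2 * w.1).
Definition cabs2 (z : R * R) : R := z.1 ^+ 2 + z.2 ^+ 2.
Definition cinv (z : R * R) : R * R := (z.1 / cabs2 z, - z.2 / cabs2 z).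
Definition cdiv (z w : R * R) : R * R := cmul z (cinv w).
Definition cone : R * R := (1, 0).
End Cplx.

(* The affine chart {d <> 0} of M_1 inside CP^3: [a:b:c:1] with        *)
(* a - b c <> 0, i.e. W(z) = (a z + b)/(c z + 1).  Real coordinates    *)
(* p = (Re a, Im a, Re b, Im b, Re c, Im c) in 'rV[R]_6.               *)
Section M1.
Variable R : realType.
Local Notation V := 'rV[R]_6.

Definition crd (p : V) (k : nat) : R := p ord0 (inord k).
Definition ca (p : V) : R * R := (crd p 0, crd p 1).
Definition cb (p : V) : R * R := (crd p 2, crd p 3).
Definition cc (p : V) : R * R := (crd p 4, crd p 5).

Definition inM1 (p : V) : Prop := csub (ca p) (cmul (cb p) (cc p)) <> (0, 0).

Definition Wmap (p : V) (z : R * R) : R * R :=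
  cdiv (cadd (cmul (ca p) z) (cb p)) (cadd (cmul (cc p) z) (cone R)).

(* the variation Wdot = d/dt W_{p + t v} at t = 0, for v = (alpha,beta,delta):
   (alpha z + beta)/(c z + 1) - (a z + b) delta z / (c z + 1)^2 *)
Definition Wdot (p v : V) (z : R * R) : R * R :=
  let den := cadd (cmul (cc p) z) (cone R) in
  csub (cdiv (cadd (cmul (ca v) z) (cb v)) den)
       (cdiv (cmul (cadd (cmul (ca p) z) (cb p)) (cmul (cc v) z)) (cmul den den)).

(* the L^2 quadratic form gamma(Wdot, Wdot) (integral over C = R^2,
   computed as an iterated Lebesgue integral of a nonnegative function) *)
Definition gammaq (p v : V) : R :=
  fine (\int[lebesgue_measure]_x
          (\int[lebesgue_measure]_y
             ((2 / (1 + x ^+ 2 + y ^+ 2) ^+ 2) *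
              (cabs2 (Wdot p v (x, y)) / (1 + cabs2 (Wmap p (x, y))) ^+ 2))%:E))%E.

Definition ebasis (i : 'I_6) : V := delta_mx 0 i.

(* metric coefficients g_ij (polarization of the quadratic form) *)
Definition gmat (p : V) : 'M[R]_6 :=
  \matrix_(i, j) ((gammaq p (ebasis i + ebasis j) - gammaq p (ebasis i)
                   - gammaq p (ebasis j)) / 2).

Definition gform (p X Y : V) : R :=
  \sum_(i < 6) \sum_(j < 6) X ord0 i * gmat p i j * Y ord0 j.

Definition ginv (p : V) : 'M[R]_6 := invmx (gmat p).

Definition dg (p : V) (k i j : 'I_6) : R :=
  derive (fun q : V => gmat q i j) p (ebasis k).

Definition Gam (p : V) (l j k : 'I_6) : R :=
  2^-1 * \sum_(m < 6) ginv p l m * (dg p j m k + dg p k m j - dg p m j k).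

(* R(d_i, d_j) d_k = sum_l Riem^l_{ijk} d_l, with the convention
   R(X,Y)Z = nabla_X nabla_Y Z - nabla_Y nabla_X Z - nabla_[X,Y] Z *)
Definition Riem (p : V) (l i j k : 'I_6) : R :=
  derive (fun q : V => Gam q l j k) p (ebasis i)
  - derive (fun q : V => Gam q l i k) p (ebasis j)
  + \sum_(m < 6) (Gam p l i m * Gam p m j k - Gam p l j m * Gam p m i k).

Definition Rm (p X Y Z W : V) : R :=
  \sum_(i < 6) \sum_(j < 6) \sum_(k < 6) \sum_(l < 6) \sum_(m < 6)
    X ord0 i * Y ord0 j * Z ord0 k * W ord0 m * gmat p m l * Riem p l i j k.

(* complex structure J: multiplication by i on each complex coordinate *)
Definition Jst (X : V) : V :=
  \row_(k < 6) (if odd k then X ord0 (inord k.-1) else - X ord0 (inord k.+1)).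

Definition Hol (p X : V) : R := Rm p X (Jst X) (Jst X) X.
End M1.

(* Main.v *)
(** The rotations W(z) |-> e^{-it} W(e^{it} z) fix the dilations W(z) = a z, so
    the complex line b = c = 0 is totally geodesic and its Gaussian curvature is
    the holomorphic sectional curvature along d/da.  Polar coordinates give
    there the conformal factor F(rho) = 2 pi N / (1 - rho)^3, rho = |a|^2,
    N = - (1 + rho) ln rho - 2 (1 - rho), whose curvature
    - 2 (rho F'/F)' / F grows like 1 / (pi rho |ln rho|^3) as rho -> 0.
    In coordinates, only the metric on the line is needed: it is diagonal there,
    and its derivatives transverse to the line vanish by the symmetry
    (a, b, c) |-> (a, - b, - c). *)
Require Import Defs.
From HB Require Import structures.
From mathcomp Require Import all_boot all_order all_algebra.
From mathcomp Require Import all_classical all_reals all_analysis.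
From mathcomp Require Import measurable_realfun ring lra.
Import Defs.
Set Implicit Arguments. Unset Strict Implicit. Unset Printing Implicit Defensive.
Import Order.TTheory GRing.Theory Num.Theory.
Import numFieldNormedType.Exports.
Local Open Scope classical_set_scope.
Local Open Scope ring_scope.

(** * Iterated integrals over the plane *)

(** Lebesgue measure is its own pushforward under [x |-> - x]. *)
Lemma ge0_integralT_opp (R : realType) (f : R -> \bar R) :
  measurable_fun [set: R] f -> (forall x, 0 <= f x)%E ->
  (\int[lebesgue_measure]_x f (- x)%R = \int[lebesgue_measure]_x f x)%E.
Proof.
move=> mf f0.
rewrite [RHS](_ : _ = (\int[pushforward lebesgue_measure
    (-%R : _ -> measurableTypeR R)]_x f x)%E).
  by rewrite ge0_integral_pushforward//.
by apply: eq_measure_integral => A mA _; exact/esym/lebesgue_measureN.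
Qed.

(** On nonnegative reals inversion is the power with exponent [-1], also at 0, where both are 0. *)
Lemma measurable_fun_invr d (T : measurableType d) (R : realType)
    (f : T -> R) :
  measurable_fun setT f -> (forall x, 0 <= f x) ->
  measurable_fun setT (fun x => (f x)^-1).
Proof.
move=> mf f0; under eq_fun do rewrite -powR_inv1//.
exact: (measurableT_comp (measurable_powR (-1)) mf).
Qed.

Section plane_integral.
Variable R : realType.
Local Notation mu := (@lebesgue_measure R).
Local Open Scope ereal_scope.

Definition int2 (f : R * R -> R) : \bar R :=
  \int[mu]_x \int[mu]_y (f (x, y))%:E.

Variable f : R * R -> R.
Hypothesis mf : measurable_fun setT f.
Hypothesis f0 : forall z, (0 <= f z)%R.

Let mEf : measurable_fun setT (EFin \o f).
Proof. exact/measurable_EFinP. Qed.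

Let Ef0 z : 0 <= (EFin \o f) z.
Proof. by rewrite lee_fin. Qed.

Lemma measurable_fun_inner : measurable_fun setT (fun x => \int[mu]_y (f (x, y))%:E).
Proof. exact: (measurable_fun_fubini_tonelli_F (m2 := mu) (EFin \o f)). Qed.

Lemma int2_ge0 : 0 <= int2 f.
Proof. by apply: integral_ge0 => x _; apply: integral_ge0 => y _; rewrite lee_fin. Qed.

Lemma int2C : int2 f = int2 (fun z => f (z.2, z.1)).
Proof. exact (fubini_tonelli (m1 := mu) (m2 := mu) (EFin \o f) mEf Ef0). Qed.

Lemma int2_oppl : int2 (fun z => f (- z.1, z.2)%R) = int2 f.
Proof.
apply: (@ge0_integralT_opp R (fun x => \int[mu]_y (f (x, y))%:E)).
  exact: measurable_fun_inner.
by move=> x; apply: integral_ge0 => y _; rewrite lee_fin.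
Qed.

End plane_integral.

Lemma int2D (R : realType) (f g : R * R -> R) :
  measurable_fun setT f -> measurable_fun setT g ->
  (forall z, 0 <= f z) -> (forall z, 0 <= g z) ->
  (int2 (fun z => (f z + g z)%R) = int2 f + int2 g)%E.
Proof.
move=> mf mg f0 g0; rewrite /int2 -ge0_integralD//; last 4 first.
- by move=> x _; apply: integral_ge0 => y _; rewrite lee_fin.
- exact: measurable_fun_inner.
- by move=> x _; apply: integral_ge0 => y _; rewrite lee_fin.
- exact: measurable_fun_inner.
apply: eq_integral => x _; rewrite -ge0_integralD//.
- by move=> y _; rewrite lee_fin.
- by apply/measurable_EFinP; apply: measurableT_comp mf _.
- by move=> y _; rewrite lee_fin.
- by apply/measurable_EFinP; apply: measurableT_comp mg _.
Qed.

(** A quarter turn is a swap of the axes, handled by Tonelli, followed by a reflection in one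
    variable. *)
Lemma int2_rot (R : realType) (f : R * R -> R) :
  measurable_fun setT f -> (forall z, 0 <= f z) ->
  int2 (fun z => f (- z.2, z.1)) = int2 f.
Proof.
move=> mf f0.
have mr : measurable_fun setT (fun z : R * R => (- z.2, z.1)).
  apply: measurable_fun_pair; last exact: measurable_fst.
  by apply: measurable_funN; exact: measurable_snd.
rewrite (int2C (f := (fun z => f (- z.2, z.1)))); first last.
- by move=> z; exact: f0.
- exact: (measurableT_comp mf mr).
exact: int2_oppl mf f0.
Qed.

(** The excluded line [x = 0], a null set of abscissae, is where the substitution [y = |x| t]
    degenerates. *)
Lemma int2_ae (R : realType) (f g : R * R -> R) :
  measurable_fun setT f -> measurable_fun setT g ->
  (forall z, 0 <= f z) -> (forall z, 0 <= g z) ->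
  (forall x, x != 0 -> (\int[lebesgue_measure]_y (f (x, y))%:E =
                       \int[lebesgue_measure]_y (g (x, y))%:E)%E) ->
  int2 f = int2 g.
Proof.
move=> mf mg f0 g0 fg; apply: ge0_ae_eq_integral => //=.
- exact: measurable_fun_inner.
- exact: measurable_fun_inner.
- by move=> x _; apply: integral_ge0 => y _; rewrite lee_fin.
- by move=> x _; apply: integral_ge0 => y _; rewrite lee_fin.
exists [set 0]; split; first exact: measurable_set1.
  exact: lebesgue_measure_set1.
move=> x /= /not_implyP[_ fgx]; apply/eqP; apply: contra_notT fgx.
exact: fg.
Qed.

(** * Derivatives in one real variable *)

Section real_derivation.
Variable R : realType.
Implicit Types (f g : R -> R) (x a b c : R).

Definition has_deriv f x a := is_derive x (1 : R) f a.

Lemma has_deriv_eq f x a b : has_deriv f x a -> a = b -> has_deriv f x b.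
Proof. by move=> ? <-. Qed.

Lemma has_deriv_cst c x : has_deriv (fun=> c) x 0.
Proof. exact: is_derive_cst. Qed.

Lemma has_deriv_id x : has_deriv (fun y => y) x 1.
Proof. exact: is_derive_id. Qed.

Lemma has_derivD f g x a b : has_deriv f x a -> has_deriv g x b ->
  has_deriv (fun y => f y + g y) x (a + b).
Proof. exact: is_deriveD. Qed.

Lemma has_derivN f x a : has_deriv f x a -> has_deriv (fun y => - f y) x (- a).
Proof. exact: is_deriveN. Qed.

Lemma has_derivM f g x a b : has_deriv f x a -> has_deriv g x b ->
  has_deriv (fun y => f y * g y) x (a * g x + f x * b).
Proof.
move=> fa gb; apply: has_deriv_eq (@is_deriveM _ _ f g x 1 a b fa gb) _.
by rewrite /GRing.scale/= addrC mulrC.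
Qed.

Lemma has_derivV f x a : f x != 0 -> has_deriv f x a ->
  has_deriv (fun y => (f y)^-1) x (- a / f x ^+ 2).
Proof.
move=> f0 fa; apply: has_deriv_eq (is_deriveV f0 fa) _.
by rewrite /GRing.scale/= mulrC mulrN mulNr.
Qed.

Lemma has_deriv_comp f g x a b : has_deriv f (g x) a -> has_deriv g x b ->
  has_deriv (fun y => f (g y)) x (a * b).
Proof. exact: is_derive1_comp. Qed.

Lemma has_deriv_ln x : 0 < x -> has_deriv (@ln R) x x^-1.
Proof. exact: is_derive1_ln. Qed.

Lemma has_deriv_continuous f x a : has_deriv f x a -> {for x, continuous f}.
Proof. by move=> [/derivable1_diffP/differentiable_continuous]. Qed.

End real_derivation.

(** By the mean value theorem [G] increases strictly on the half-line, so [G 0 < G 1 <= l]. The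
    intermediate point is interior, hence [g] may vanish at 0. *)
Lemma lt_limit_of_deriv_gt0 (R : realType) (g G : R -> R) (l : R) :
  (forall u, 0 <= u -> has_deriv G u (g u)) ->
  (forall u, 0 < u -> 0 < g u) ->
  G u @[u --> +oo] --> l -> G 0 < l.
Proof.
move=> dG g0 Gl.
have incr a b : 0 <= a -> a < b -> G a < G b.
  move=> a0 ab; have [|c|c] := @MVT _ G g _ _ ab.
  - move=> x; rewrite in_itv/= => /andP[ax _]; apply: dG.
    exact/ltW/(le_lt_trans a0).
  - apply: derivable_within_continuous => x; rewrite in_itv/= => /andP[ax _].
    by have [] := dG x (le_trans a0 ax).
  - rewrite in_itv/= => /andP[ac _] Gab; rewrite -subr_gt0 Gab mulr_gt0 ?subr_gt0//.
    by apply/g0/(le_lt_trans a0).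
apply: (@lt_le_trans _ _ (G 1)); first exact: incr.
apply: (cvgr_to_ge Gl); near=> u.
by apply/ltW/incr => //; near: u; exact: nbhs_pinfty_gt.
Unshelve. all: by end_near. Qed.

(** * Integrals of radial functions *)

Section radial.
Variable R : realType.
Variables (g G : R -> R) (l : R).
Hypothesis cg : continuous g.
Hypothesis g0 : forall u, 0 <= g u.
Hypothesis dG : forall u, 0 <= u -> has_deriv G u (g u).
Hypothesis Gl : G u @[u --> +oo] --> l.
Local Notation mu := (@lebesgue_measure R).

Let continuous_sqr : continuous (fun x : R => x ^+ 2).
Proof. exact: exprn_continuous. Qed.

Lemma integral_scale (x : R) : x != 0 ->
  (\int[mu]_y (g (x ^+ 2 + y ^+ 2))%:E =
   \int[mu]_t (g (x ^+ 2 * (1 + t ^+ 2)) * `|x|)%:E)%E.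
Proof.
move=> x0; have nx : 0 < `|x| by rewrite normr_gt0.
have dF t : has_deriv (fun t => `|x| * t) t `|x|.
  apply: has_deriv_eq; first exact: has_derivM (has_deriv_cst _ _) (has_deriv_id _).
  by rewrite mul0r add0r mulr1.
have F' : derive1 (fun t => `|x| * t) = cst `|x|.
  by apply/funext => t; rewrite derive1E; have [_ ->] := dF t.
rewrite (@increasing_ge0_integration_by_substitutionT R (fun t => `|x| * t)
  (fun y => g (x ^+ 2 + y ^+ 2))) //.
- apply: eq_integral => t _; rewrite F' /= !fctE; congr (g _ * _)%:E.
  by rewrite exprMn real_normK ?num_real// mulrDr mulr1.
- by move=> a b ab; rewrite ltr_pM2l.
- by rewrite F' => ?; exact: cvg_cst.
- by rewrite F'; exact: is_cvg_cst.
- by rewrite F'; exact: is_cvg_cst.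
- exact: gt0_cvgMrNy.
- exact: gt0_cvgMry.
- move=> y; apply: continuous_comp; last exact: cg.
  by apply: cvgD; [exact: cvg_cst|exact: continuous_sqr].
Qed.

(** With [k = 1 + t^2], a primitive of [g (x^2 k) x] is [G (x^2 k) / (2 k)]. The integrand is even,
    and doubling the half-line integral cancels the 2. *)
Lemma integral_ray (t : R) :
  (\int[mu]_x (g (x ^+ 2 * (1 + t ^+ 2)) * `|x|)%:E =
   ((l - G 0) * (oneDsqr t)^-1)%:E)%E.
Proof.
set k := 1 + t ^+ 2; have k0 : 0 < k by rewrite ltr_pwDl// sqr_ge0.
have ck : continuous (fun x : R => g (x ^+ 2 * k) * `|x|).
  move=> x; apply: cvgM; last exact: norm_continuous.
  apply: continuous_comp; last exact: cg.
  by apply: cvgM; [exact: continuous_sqr|exact: cvg_cst].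
have dH (x : R) : has_deriv (fun x => G (x ^+ 2 * k) / (2 * k)) x
    (g (x ^+ 2 * k) * x).
  have dGx := dG (mulr_ge0 (sqr_ge0 x) (ltW k0)).
  have dq : has_deriv (fun x => x ^+ 2 * k) x (2 * x * k).
    apply: has_deriv_eq.
      exact: has_derivM (has_derivM (has_deriv_id _) (has_deriv_id _)) (has_deriv_cst _ _).
    by rewrite /=; ring.
  apply: has_deriv_eq.
    have dc := @has_deriv_comp _ G (fun x => x ^+ 2 * k) x _ _ dGx dq.
    exact: has_derivM dc (has_deriv_cst (2 * k)^-1 x).
  by rewrite /=; field; rewrite gt_eqF.
rewrite ge0_symfun_integralT//; last 2 first.
- by move=> x; rewrite mulr_ge0.
- by move=> x /=; rewrite sqrrN normrN.
rewrite -set_itvcy.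
have -> : (\int[mu]_(x in `[0%R, +oo[) (g (x ^+ 2 * k) * `|x|)%:E =
           \int[mu]_(x in `[0%R, +oo[) (g (x ^+ 2 * k) * x)%:E)%E.
  apply: eq_integral => x; rewrite inE/= in_itv/= andbT => x0.
  by rewrite ger0_norm.
rewrite (@ge0_continuous_FTC2y _ _ (fun x => G (x ^+ 2 * k) / (2 * k)) 0
   (l / (2 * k))).
- rewrite expr0n mul0r -EFinB -EFinM /oneDsqr -/k; congr EFin.
  by rewrite /=; field; rewrite gt_eqF.
- by move=> x x0; rewrite mulr_ge0.
- apply: continuous_subspaceT => x; apply: cvgM; last exact: cvg_id.
  apply: continuous_comp; last exact: cg.
  by apply: cvgM; [exact: continuous_sqr|exact: cvg_cst].
- apply: cvgM; last exact: cvg_cst.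
  apply: (cvg_comp (fun x => x ^+ 2 * k) G _ Gl).
  exact/gt0_cvgMly/cvgr_expr2.
- by move=> x _; have [] := dH x.
- by apply/cvg_at_right_filter; exact: has_deriv_continuous (dH 0).
- by move=> x _; rewrite derive1E; have [_ ->] := dH x.
Qed.

(** The value is the nonnegative integral along the ray [t = 0]. *)
Lemma limit_ge : 0 <= l - G 0.
Proof.
have /eqP := integral_ray 0; rewrite /oneDsqr expr0n addr0 invr1 mulr1 => /eqP h.
by rewrite -lee_fin -h; apply: integral_ge0 => x _; rewrite lee_fin mulr_ge0.
Qed.

Lemma measurable_fun_radial : measurable_fun setT (fun z : R * R => g (z.1 ^+ 2 + z.2 ^+ 2)).
Proof.
apply: measurableT_comp; first exact: continuous_measurable_fun.
by apply: measurable_funD; apply: measurable_funX;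
  [exact: measurable_fst|exact: measurable_snd].
Qed.

(* Substituting y = |x| t sends x^2 + y^2 to x^2 (1 + t^2), so that after Tonelli
   the inner integral is elementary and the outer one is that of 1 / (1 + t^2). *)
Lemma int2_radial :
  int2 (fun z => g (z.1 ^+ 2 + z.2 ^+ 2)) = (pi * (l - G 0))%:E.
Proof.
pose h (z : R * R) := g (z.1 ^+ 2 * (1 + z.2 ^+ 2)) * `|z.1|.
have mh : measurable_fun setT h.
  apply: measurable_funM; last first.
    by apply: measurableT_comp => //; exact: measurable_fst.
  apply: measurableT_comp; first exact: continuous_measurable_fun.
  apply: measurable_funM.
    by apply: measurable_funX; exact: measurable_fst.
  apply: measurable_funD => //.
  by apply: measurable_funX; exact: measurable_snd.
have h0 z : 0 <= h z by rewrite mulr_ge0.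
rewrite (int2_ae measurable_fun_radial mh)//; last by move=> x; exact: integral_scale.
rewrite int2C// /int2 /h /=.
under eq_integral do rewrite integral_ray EFinM.
have co := @continuous_oneDsqrV R.
have o0 (x : R) : 0 <= (oneDsqr x)^-1 by rewrite invr_ge0 ltW ?oneDsqr_gt0.
rewrite ge0_integralZl//; last 2 first.
- by apply/measurable_EFinP; exact: continuous_measurable_fun co.
- by rewrite lee_fin limit_ge.
rewrite ge0_symfun_integralT//; last first.
  by move=> x; rewrite /= /oneDsqr sqrrN.
rewrite -set_itvcy integral0y_oneDsqr -!EFinM; congr EFin.
by field.
Qed.
End radial.

(** * The radial integrals *)

(* [hA r] and [hB r] are the integrals over u > 0 of u / D u and 1 / D u, where
   D u = (1 + u)^2 (1 + r u)^2; the integral of r u^2 / D u is again [hB r]. *)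
Section radial_profile.
Variable R : realType.
Variable r : R.
Hypothesis r01 : 0 < r < 1.

Definition hA : R := ((1 + r) * - ln r - 2 * (1 - r)) / (1 - r) ^+ 3.
Definition hB : R := (1 - r ^+ 2 + 2 * r * ln r) / (1 - r) ^+ 3.

Variables A B E : R.
Hypotheses (A0 : 0 <= A) (B0 : 0 <= B) (E0 : 0 <= E).

(** Twice [(A u + B + E u^2) / D u] in the variable [u = |z|^2]. The absolute values extend it to a
    continuous nonnegative function on the whole line, as the section on radial functions
    requires. *)
Definition profile (u : R) : R :=
  2 * (A * `|u| + B + E * `|u| ^+ 2) /
  ((1 + `|u|) ^+ 2 * (1 + r * `|u|) ^+ 2).

Let r0 : 0 < r. Proof. by case/andP: r01. Qed.
Let r1 : 0 < 1 - r. Proof. by rewrite subr_gt0; case/andP: r01. Qed.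

Let pos1 (u : R) : 0 <= u -> 0 < 1 + u.
Proof. by move=> u0; rewrite ltr_wpDr. Qed.

Let posr (u : R) : 0 <= u -> 0 < 1 + r * u.
Proof. by move=> u0; rewrite ltr_wpDr// mulr_ge0// ltW. Qed.

Let posL (u : R) : 0 <= u -> 0 < r + (1 - r) / (1 + u).
Proof. by move=> u0; rewrite ltr_wpDr// ltW// divr_gt0// pos1. Qed.

Lemma profile_ge0 u : 0 <= profile u.
Proof.
have p1 := pos1 (normr_ge0 u); have pr := posr (normr_ge0 u).
apply: divr_ge0; last by apply: mulr_ge0; apply/exprn_ge0/ltW.
by apply: mulr_ge0 => //; rewrite !addr_ge0// mulr_ge0// exprn_ge0.
Qed.

Lemma profile_continuous : continuous profile.
Proof.
move=> u; have cn := @norm_continuous _ R u.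
have cst c : (fun=> c : R) x @[x --> u] --> (c : R) by exact: cvg_cst.
apply: cvgM.
  apply: cvgM; first exact: cst.
  apply: cvgD; first (apply: cvgD; last exact: cst).
    by apply: cvgM; [exact: cst|exact: cn].
  by apply: cvgM; [exact: cst|apply: cvgM; exact: cn].
have c1 : 1 + `|x| @[x --> u] --> 1 + `|u| by apply: cvgD; [exact: cst|exact: cn].
have c2 : 1 + r * `|x| @[x --> u] --> 1 + r * `|u|.
  by apply: cvgD; [exact: cst|apply: cvgM; [exact: cst|exact: cn]].
apply: cvgV; last by apply: cvgM; apply: cvgM.
by apply: mulf_neq0; apply/expf_neq0/lt0r_neq0; [exact: pos1|exact: posr].
Qed.

(** This is [ln ((1 + u) / (1 + r u))], written so that its value 0 at [u = 0] and its limit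
    [- ln r] at infinity can be read off. *)
Let Lam (u : R) := - ln (r + (1 - r) / (1 + u)).

(** The primitive obtained by partial fractions, with [L], [i1], [ir] standing for the logarithm,
    [1 / (1 + u)] and [1 / (1 + r u)]. The same expression then serves for the limit at infinity. *)
Let coef (L i1 ir : R) := 2 / (1 - r) ^+ 2 *
  (A * ((1 + r) / (1 - r) * L + (i1 + ir))
   - B * (i1 + r * ir + 2 * r / (1 - r) * L)
   - E * (ir / r + i1 + 2 / (1 - r) * L)).

Definition profile_prim (u : R) : R := coef (Lam u) (1 + u)^-1 (1 + r * u)^-1.

Definition profile_lim : R := coef (- ln r) 0 0.

Lemma profile_lim_sub :
  profile_lim - profile_prim 0 = 2 * (A * hA + (B + E / r) * hB).
Proof.
rewrite /profile_prim /profile_lim /Lam addr0 mulr0 addr0 !invr1 mulr1.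
have -> : r + (1 - r) = 1 by ring.
rewrite ln1 oppr0 /coef /hA /hB.
by field; rewrite !gt_eqF.
Qed.

Lemma profile_prim_deriv u : 0 <= u -> has_deriv profile_prim u (profile u).
Proof.
move=> u0.
have d1 : has_deriv (fun u => 1 + u) u 1.
  apply: has_deriv_eq (has_derivD (has_deriv_cst 1 u) (has_deriv_id u)) _.
  by rewrite add0r.
have dr : has_deriv (fun u => 1 + r * u) u r.
  apply: has_deriv_eq (has_derivD (has_deriv_cst 1 u)
    (has_derivM (has_deriv_cst r u) (has_deriv_id u))) _ => /=; ring.
have p1 := pos1 u0; have pr := posr u0; have pL := posL u0.
have di1 := has_derivV (f := fun u => 1 + u) (lt0r_neq0 p1) d1.
have dir := has_derivV (f := fun u => 1 + r * u) (lt0r_neq0 pr) dr.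
have dL : has_deriv Lam u ((1 - r) / ((1 + u) * (1 + r * u))).
  have di := has_derivD (has_deriv_cst r u)
    (has_derivM (has_deriv_cst (1 - r) u) di1).
  have dln := @has_deriv_comp R (@ln R) (fun u => r + (1 - r) * (1 + u)^-1) u _ _
     (has_deriv_ln pL) di.
  apply: has_deriv_eq (has_derivN dln) _ => /=.
  have -> : r + (1 - r) / (1 + u) = (1 + r * u) / (1 + u).
    by field; rewrite gt_eqF.
  by field; rewrite !gt_eqF.
pose c := fun k : R => has_deriv_cst k u.
have dA := has_derivM (c A) (has_derivD (has_derivM (c ((1 + r) / (1 - r))) dL)
  (has_derivD di1 dir)).
have dB := has_derivM (c B) (has_derivD (has_derivD di1 (has_derivM (c r) dir))
  (has_derivM (c (2 * r / (1 - r))) dL)).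
have dE := has_derivM (c E) (has_derivD (has_derivD (has_derivM dir (c r^-1)) di1)
  (has_derivM (c (2 / (1 - r))) dL)).
have := has_derivM (c (2 / (1 - r) ^+ 2)) (has_derivD (has_derivD dA (has_derivN dB))
  (has_derivN dE)).
move=> h; apply: has_deriv_eq h _ => /=.
rewrite /profile ger0_norm//.
by field; rewrite !gt_eqF.
Qed.

Lemma profile_prim_lim : profile_prim u @[u --> +oo] --> profile_lim.
Proof.
have c1 : (1 + u)^-1 @[u --> +oo] --> (0 : R).
  apply/gtr0_cvgV0; first by near=> u; apply: pos1; near: u; exact: nbhs_pinfty_ge.
  apply: (@ger_cvgy _ _ _ _ id); last exact: cvg_id.
  by near=> u; rewrite /= lerDr.
have cr : (1 + r * u)^-1 @[u --> +oo] --> (0 : R).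
  apply/gtr0_cvgV0; first by near=> u; apply: posr; near: u; exact: nbhs_pinfty_ge.
  apply: (@ger_cvgy _ _ _ _ (fun u => r * u)); last exact: gt0_cvgMry cvg_id.
  by near=> u; rewrite /= lerDr.
have cL : Lam u @[u --> +oo] --> - ln r.
  apply: cvgN; apply: continuous_cvg; first exact: continuous_ln r0.
  rewrite [X in _ --> X](_ : r = r + (1 - r) * 0); last by ring.
  by apply: cvgD; [exact: cvg_cst|apply: cvgM; [exact: cvg_cst|exact: c1]].
have cst c : (fun=> c : R) x @[x --> +oo] --> (c : R) by exact: cvg_cst.
rewrite /profile_prim /profile_lim /coef.
have kM k (f : R -> R) a : f x @[x --> +oo] --> a -> k * f x @[x --> +oo] --> k * a.
  by move=> fa; apply: cvgM; first exact: cst.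
apply: (kM); apply: cvgB; first apply: cvgB.
- by apply: (kM); apply: cvgD; [exact: kM cL|exact: cvgD c1 cr].
- by apply: (kM); apply: cvgD; [exact: cvgD c1 (kM _ _ _ cr)|exact: kM cL].
- apply: (kM); apply: cvgD; last exact: kM cL.
  by apply: cvgD c1; apply: cvgM cr _; exact: cst.
Unshelve. all: by end_near. Qed.

Lemma int2_profile :
  int2 (fun z => profile (z.1 ^+ 2 + z.2 ^+ 2)) =
  (pi * (2 * (A * hA + (B + E / r) * hB)))%:E.
Proof.
rewrite (int2_radial profile_continuous profile_ge0 profile_prim_deriv
  profile_prim_lim).
by rewrite profile_lim_sub.
Qed.

(** The signs of [hA] and [hB] come from here: they are read off from the positive integrands
    instead of the logarithmic closed forms. *)
Lemma profile_lim_gt0 : (forall u, 0 < u -> 0 < A * u + B + E * u ^+ 2) ->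
  0 < A * hA + (B + E / r) * hB.
Proof.
move=> pos; rewrite -(@pmulr_rgt0 _ 2)// -profile_lim_sub subr_gt0.
apply: (lt_limit_of_deriv_gt0 profile_prim_deriv _ profile_prim_lim) => u u0.
have u0' := ltW u0; rewrite /profile ger0_norm// divr_gt0//.
  by rewrite mulr_gt0// pos.
by apply: mulr_gt0; apply: exprn_gt0; [exact: pos1|exact: posr].
Qed.

End radial_profile.

Lemma hA_gt0 (R : realType) (r : R) : 0 < r < 1 -> 0 < hA r.
Proof.
move=> r01; have := @profile_lim_gt0 R r r01 1 0 0; rewrite !mul0r !add0r mul0r mul1r.
by rewrite addr0; apply => u u0; rewrite mul0r mul1r !addr0.
Qed.

Lemma hB_gt0 (R : realType) (r : R) : 0 < r < 1 -> 0 < hB r.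
Proof.
move=> r01; have := @profile_lim_gt0 R r r01 0 1 0; rewrite !mul0r addr0 add0r mul1r.
by apply => u u0; rewrite !mul0r addr0 add0r.
Qed.

(** * The metric on the line of dilations *)

Section measurable_complex.
Variable R : realType.
Implicit Types F G : R * R -> R * R.

Definition cmeasurable F :=
  measurable_fun setT (fun z => (F z).1) /\ measurable_fun setT (fun z => (F z).2).

Lemma cmeasurable_cst c : cmeasurable (fun=> c).
Proof. by split; exact: measurable_cst. Qed.

Lemma cmeasurable_id : cmeasurable id.
Proof. by split; [exact: measurable_fst|exact: measurable_snd]. Qed.

Lemma cmeasurableD F G : cmeasurable F -> cmeasurable G ->
  cmeasurable (fun z => cadd (F z) (G z)).
Proof. by move=> [? ?] [? ?]; split; exact: measurable_funD. Qed.

Lemma cmeasurableB F G : cmeasurable F -> cmeasurable G ->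
  cmeasurable (fun z => csub (F z) (G z)).
Proof. by move=> [? ?] [? ?]; split; exact: measurable_funB. Qed.

Lemma cmeasurableM F G : cmeasurable F -> cmeasurable G ->
  cmeasurable (fun z => cmul (F z) (G z)).
Proof.
move=> [? ?] [? ?]; split.
  by apply: measurable_funB; exact: measurable_funM.
by apply: measurable_funD; exact: measurable_funM.
Qed.

Lemma measurable_cabs2 F : cmeasurable F -> measurable_fun setT (fun z => cabs2 (F z)).
Proof. by move=> [? ?]; apply: measurable_funD; exact: measurable_funX. Qed.

Lemma cabs2_ge0 (z : R * R) : 0 <= cabs2 z.
Proof. by rewrite addr_ge0// sqr_ge0. Qed.

Lemma cmeasurable_div F G : cmeasurable F -> cmeasurable G ->
  cmeasurable (fun z => cdiv (F z) (G z)).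
Proof.
move=> mF mG; apply: cmeasurableM => //.
have mi : measurable_fun setT (fun z => (cabs2 (G z))^-1).
  by apply: measurable_fun_invr; [exact: measurable_cabs2|move=> z; exact: cabs2_ge0].
case: mG => m1 m2; split; first exact: measurable_funM.
by apply: measurable_funM => //; exact: measurable_funN.
Qed.

End measurable_complex.

Section density.
Variable R : realType.
Implicit Types (p v : 'rV[R]_6) (z : R * R).

Definition density p v z : R :=
  (2 / (1 + z.1 ^+ 2 + z.2 ^+ 2) ^+ 2) *
  (cabs2 (Wdot p v z) / (1 + cabs2 (Wmap p z)) ^+ 2).

Lemma gammaqE p v : gammaq p v = fine (int2 (density p v)).
Proof. by []. Qed.

Lemma density_ge0 p v z : 0 <= density p v z.
Proof.
apply: mulr_ge0; apply: divr_ge0 => //; first exact: sqr_ge0.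
  exact: cabs2_ge0.
exact: sqr_ge0.
Qed.

Lemma measurable_density p v : measurable_fun setT (density p v).
Proof.
have mden : cmeasurable (fun z => cadd (cmul (cc p) z) (cone R)).
  by do ?[exact: cmeasurable_cst|exact: cmeasurable_id|apply: cmeasurableD|apply: cmeasurableM].
have mlin u : cmeasurable (fun z => cadd (cmul (ca u) z) (cb u)).
  by do ?[exact: cmeasurable_cst|exact: cmeasurable_id|apply: cmeasurableD|apply: cmeasurableM].
apply: measurable_funM; apply: measurable_funM => //.
- apply: measurable_fun_invr => [|z]; last exact: sqr_ge0.
  apply: measurable_funX; apply: measurable_funD; last first.
    by apply: measurable_funX; exact: measurable_snd.
  by apply: measurable_funD => //; apply: measurable_funX; exact: measurable_fst.
- apply: measurable_cabs2; apply: cmeasurableB; apply: cmeasurable_div => //.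
    apply: cmeasurableM => //; apply: cmeasurableM; [exact: cmeasurable_cst|exact: cmeasurable_id].
  exact: cmeasurableM.
- apply: measurable_fun_invr => [|z]; last exact: sqr_ge0.
  apply: measurable_funX; apply: measurable_funD => //.
  by apply: measurable_cabs2; apply: cmeasurable_div.
Qed.

Definition cneg z : R * R := (- z.1, - z.2).

(* The isometry W |-> (z |-> - W (- z)) acts by (a, b, c) |-> (a, - b, - c). *)
Lemma gammaq_sym p p' v : ca p' = ca p -> cb p' = cneg (cb p) ->
  cc p' = cneg (cc p) -> cb v = (0, 0) -> cc v = (0, 0) ->
  gammaq p' v = gammaq p v.
Proof.
move=> ea eb ec vb vc; rewrite (gammaqE p') (gammaqE p).
suff -> : int2 (density p' v) = int2 (density p v) by [].
have md := measurable_density p' v.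
(* Two quarter turns make [z |-> - z], which carries one density to the other pointwise. *)
rewrite -(int2_rot md (density_ge0 p' v)).
rewrite -(@int2_rot _ (fun z => density p' v (- z.2, z.1))); last 2 first.
- apply: (measurableT_comp md); apply: measurable_fun_pair; last exact: measurable_fst.
  by apply: measurable_funN; exact: measurable_snd.
- by move=> z; exact: density_ge0.
congr int2; apply/funext => -[x y] /=.
have dE : cadd (cmul (cc p') (- x, - y)) (cone R) = cadd (cmul (cc p) (x, y)) (cone R).
  by rewrite ec /cadd /cmul /=; congr pair; ring.
have nE : cadd (cmul (ca p') (- x, - y)) (cb p') = cneg (cadd (cmul (ca p) (x, y)) (cb p)).
  by rewrite ea eb /cadd /cmul /cneg /=; congr pair; ring.
have WE : cabs2 (Wmap p' (- x, - y)) = cabs2 (Wmap p (x, y)).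
  rewrite /Wmap dE nE /cdiv; move: (cinv _) => d.
  by rewrite /cneg /cmul /cabs2/=; ring.
have WdE : cabs2 (Wdot p' v (- x, - y)) = cabs2 (Wdot p v (x, y)).
  rewrite /Wdot dE nE vb vc /cdiv /=; move: (cinv _) (cinv _) => d d'.
  by rewrite /cneg /csub /cadd /cmul /cabs2/=; ring.
by rewrite /density WE WdE /= !sqrrN.
Qed.

End density.

Section metric_on_dilations.
Variable R : realType.
Implicit Types (p v : 'rV[R]_6) (z : R * R).

Lemma cdiv1 (w : R * R) : cdiv w (cone R) = w.
Proof.
case: w => a b; rewrite /cdiv /cinv /cmul /cabs2 /cone /=.
by rewrite expr1n expr0n addr0 !divr1; congr pair; ring.
Qed.

(** Here [W] is [a z] and its variation is the polynomial [al z + be - a de z^2]; the denominator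
    depends on [|z|^2] alone. *)
Lemma density_dilation p v z : cb p = (0, 0) -> cc p = (0, 0) ->
  density p v z =
  2 * cabs2 (csub (cadd (cmul (ca v) z) (cb v))
                  (cmul (cmul (ca p) (cc v)) (cmul z z))) /
  ((1 + (z.1 ^+ 2 + z.2 ^+ 2)) ^+ 2 *
   (1 + cabs2 (ca p) * (z.1 ^+ 2 + z.2 ^+ 2)) ^+ 2).
Proof.
move=> b0 c0; rewrite /density /Wdot /Wmap.
have -> : cadd (cmul (cc p) z) (cone R) = cone R.
  by rewrite c0 /cadd /cmul /cone /=; congr pair; ring.
have -> : cmul (cone R) (cone R) = cone R.
  by rewrite /cmul /cone /=; congr pair; ring.
rewrite !cdiv1 b0.
set N := cabs2 _; set N' := cabs2 (csub _ _).
have -> : N = N'.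
  by rewrite /N /N' /csub /cadd /cmul /cabs2 /=; ring.
have -> : cabs2 (cadd (cmul (ca p) z) (0, 0)) = cabs2 (ca p) * (z.1 ^+ 2 + z.2 ^+ 2).
  by rewrite /cadd /cmul /cabs2 /=; ring.
by rewrite !invfM addrA; ring.
Qed.

(** The term [a de z^2] contributes [r |de|^2 u^2], whose factor [r] cancels the [1 / r] of
    [int2_profile]; thus [b] and [c] get the same weight. *)
Lemma gammaq_dilation p v : cb p = (0, 0) -> cc p = (0, 0) ->
  0 < cabs2 (ca p) < 1 ->
  gammaq p v = 2 * pi * (cabs2 (ca v) * hA (cabs2 (ca p)) +
     (cabs2 (cb v) + cabs2 (cc v)) * hB (cabs2 (ca p))).
Proof.
move=> b0 c0; set r := cabs2 (ca p) => r01; rewrite gammaqE.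
have md := measurable_density p v; have d0 := density_ge0 p v.
pose rot (f : R * R -> R) := fun z : R * R => f (- z.2, z.1).
have mrot f : measurable_fun setT f -> measurable_fun setT (rot f).
  move=> mf; apply: (measurableT_comp mf).
  apply: measurable_fun_pair; last exact: measurable_fst.
  by apply: measurable_funN; exact: measurable_snd.
set d := density p v in md d0 *.
have m1 := mrot _ md; have m2 := mrot _ m1; have m3 := mrot _ m2.
have nrot f : (forall z, 0 <= f z) -> forall z, 0 <= rot f z by move=> f0 z; exact: f0.
have n1 := nrot _ d0; have n2 := nrot _ n1; have n3 := nrot _ n2.
(* Averaging over z |-> i^k z kills the cross terms of |al z + be - a de z^2|^2. *)
have avg : int2 (fun z => (d z + rot d z) + (rot (rot d) z + rot (rot (rot d)) z)) =
    ((int2 d + int2 d) + (int2 d + int2 d))%E.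
  have i1 : int2 (rot d) = int2 d := int2_rot md d0.
  have i2 : int2 (rot (rot d)) = int2 d := etrans (int2_rot m1 n1) i1.
  have i3 : int2 (rot (rot (rot d))) = int2 d := etrans (int2_rot m2 n2) i2.
  rewrite (int2D (measurable_funD md m1) (measurable_funD m2 m3))/=.
  - by rewrite (int2D md m1 d0 n1) (int2D m2 m3 n2 n3) i1 i2 i3.
  - by move=> z; apply: addr_ge0; [exact: d0|exact: n1].
  - by move=> z; apply: addr_ge0; [exact: n2|exact: n3].
have prof z : (d z + rot d z) + (rot (rot d) z + rot (rot (rot d)) z) =
  profile r (4 * cabs2 (ca v)) (4 * cabs2 (cb v)) (4 * (r * cabs2 (cc v)))
    (z.1 ^+ 2 + z.2 ^+ 2).
  rewrite /rot /d !density_dilation// -/r /=.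
  rewrite /profile ger0_norm ?addr_ge0 ?sqr_ge0//.
  rewrite !opprK !sqrrN ![z.2 ^+ 2 + z.1 ^+ 2]addrC -!mulrDl; congr (_ / _).
  by rewrite /r /csub /cadd /cmul /cabs2 /=; ring.
move: avg; rewrite (_ : (fun z => _) = (fun z => profile r (4 * cabs2 (ca v))
  (4 * cabs2 (cb v)) (4 * (r * cabs2 (cc v))) (z.1 ^+ 2 + z.2 ^+ 2))); last first.
  exact/funext/prof.
have r0 : 0 < r by case/andP: r01.
rewrite int2_profile//; last 3 first.
- by rewrite mulr_ge0// cabs2_ge0.
- by rewrite mulr_ge0// cabs2_ge0.
- by rewrite !mulr_ge0// ?cabs2_ge0// ltW.
move=> e.
have -> : int2 d = (2 * pi * (cabs2 (ca v) * hA r +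
     (cabs2 (cb v) + cabs2 (cc v)) * hB r))%:E.
  (* The averaged identity also excludes an infinite integral, so [fine] loses nothing. *)
  case: (int2 d) (int2_ge0 d0) e => [x _|//|//].
  move=> [e]; congr EFin; apply: (@mulfI _ (4 : R)); first by rewrite pnatr_eq0.
  rewrite [LHS](_ : _ = x + x + (x + x)); last by ring.
  by rewrite -e; field; rewrite gt_eqF.
by [].
Qed.
End metric_on_dilations.

(** * Metric coefficients on the line, and directional derivatives *)

Section diagonal_metric.
Variable R : realType.
Implicit Types (p q v : 'rV[R]_6) (i j k l m n : 'I_6).

(** The coefficient [a] is complex here. The bounds avoid the poles of the closed forms at
    [rho = 1], and the region contains the end [rho -> 0] where the curvature blows up. *)
Definition dilation p :=
  [/\ cb p = (0, 0), cc p = (0, 0) & 0 < cabs2 (ca p) < 1].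

Definition rho p := cabs2 (ca p).

Definition gdiag p k : R :=
  2 * pi * (if (k < 2)%N then hA (rho p) else hB (rho p)).

Lemma gdiag_gt0 p k : dilation p -> 0 < gdiag p k.
Proof.
move=> [_ _ r01]; rewrite /gdiag !mulr_gt0// ?pi_gt0//.
by case: ifP => _; [exact: hA_gt0|exact: hB_gt0].
Qed.

Lemma rhoE p : rho p = p ord0 (inord 0) ^+ 2 + p ord0 (inord 1) ^+ 2.
Proof. by []. Qed.

Lemma sum6 (F : 'I_6 -> R) :
  \sum_k F k = F (inord 0) + F (inord 1) + F (inord 2) + F (inord 3)
             + F (inord 4) + F (inord 5).
Proof.
rewrite !big_ord_recr big_ord0 /= add0r.
by do ![congr (_ + _)]; congr F; apply/val_inj; rewrite /= inordK.
Qed.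

Lemma gammaq_diag p v : dilation p ->
  gammaq p v = \sum_k gdiag p k * v ord0 k ^+ 2.
Proof.
move=> [b0 c0 r01]; rewrite gammaq_dilation// sum6 /gdiag !inordK//=.
by rewrite -/(rho p) /cabs2 /ca /cb /cc /crd /=; ring.
Qed.

Lemma gmat_dilation p i j : dilation p -> gmat p i j = (i == j)%:R * gdiag p i.
Proof.
move=> hp; rewrite mxE !gammaq_diag//.
rewrite -!sumrB mulr_suml (bigD1 i)//= big1 ?addr0; last first.
  move=> k /negPf ki; rewrite /ebasis !mxE !eqxx ki /=.
  by rewrite add0r (expr0n _ 2) /= mulr0 subr0 subrr mul0r.
rewrite /ebasis !mxE !eqxx /=.
by case: (i == j) => /=; rewrite ?mulr1n ?mulr0n; field.
Qed.

Lemma ginv_dilation p i j : dilation p -> ginv p i j = (i == j)%:R / gdiag p i.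
Proof.
move=> hp; pose d : 'rV[R]_6 := \row_k gdiag p k.
pose d' : 'rV[R]_6 := \row_k (gdiag p k)^-1.
have gE : gmat p = diag_mx d.
  by apply/matrixP => a b; rewrite gmat_dilation// !mxE mulr_natl.
have gd : gmat p *m diag_mx d' = 1%:M.
  rewrite gE mulmx_diag -diag_const_mx; congr diag_mx.
  by apply/rowP => k; rewrite !mxE divff// gt_eqF// gdiag_gt0.
have [gu _] := mulmx1_unit gd.
have -> : ginv p = diag_mx d' by rewrite -[RHS](mulKmx gu) gd mulmx1.
by rewrite !mxE mulr_natl.
Qed.

Lemma derive_line (f : 'rV[R]_6 -> R) p v :
  derive f p v = derive (fun h : R => f (h *: v + p)) 0 1.
Proof.
rewrite /derive; congr (lim (_ @ 0^')); apply/funext => h /=.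
by rewrite scale0r add0r /GRing.scale/= mulr1 addr0.
Qed.

(** A directional derivative sees only the values on a short segment, so a closed form valid on
    dilations alone can be differentiated along them. *)
Lemma derive_lineE (f : 'rV[R]_6 -> R) (phi : R -> R) p v a :
  (\forall h \near (0 : R), f (h *: v + p) = phi h) -> has_deriv phi 0 a ->
  derive f p v = a.
Proof.
move=> fphi [_ <-]; rewrite derive_line.
exact: near_eq_derive.
Qed.

(* Differentiability is not assumed: [derive] is [0] where the limit fails to
   exist. *)
Lemma derive_even (f : 'rV[R]_6 -> R) p v :
  (forall h, f (- h *: v + p) = f (h *: v + p)) -> derive f p v = 0.
Proof.
move=> ev; rewrite derive_line; set g := fun h : R => _.
have [dg|ndg] := pselect (derivable g 0 1); last exact: dvgP.
have gd : has_deriv g 0 (derive g 0 1) by apply/derivableP.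
have gd' : has_deriv g (- 0) (derive g 0 1) by rewrite oppr0.
have := has_deriv_comp gd' (has_derivN (has_deriv_id (0 : R))).
rewrite (_ : (fun _ => _) = g); last by apply/funext => h; rewrite /g ev.
move=> [_]; lra.
Qed.

End diagonal_metric.

(** * Connection and curvature *)

Section log_derivative.
Variable R : realType.
Implicit Types r : R.

(** [num] is the [N] of the conformal factor, [dnum] its derivative, [psi] the logarithmic
    derivative [F' / F], and [dpsi] the derivative of [psi]. *)
Definition num r : R := (1 + r) * - ln r - 2 * (1 - r).
Definition dnum r : R := - ln r + 1 - r^-1.
Definition psi r : R := dnum r / num r + 3 / (1 - r).
Definition dpsi r : R :=
  (r ^- 2 - r^-1) / num r - dnum r ^+ 2 / num r ^+ 2 + 3 / (1 - r) ^+ 2.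

Lemma num_gt0 r : 0 < r < 1 -> 0 < num r.
Proof.
move=> r01; have := hA_gt0 r01; rewrite /hA -/(num r) pmulr_lgt0// invr_gt0 exprn_gt0//.
by rewrite subr_gt0; case/andP: r01.
Qed.

Lemma num_deriv r : 0 < r -> has_deriv num r (dnum r).
Proof.
move=> r0; have c k := has_deriv_cst k r; have i := has_deriv_id r.
apply: has_deriv_eq (has_derivD (has_derivM (has_derivD (c 1) i)
  (has_derivN (has_deriv_ln r0)))
  (has_derivN (has_derivM (c 2) (has_derivD (c 1) (has_derivN i))))) _.
by rewrite /dnum /=; field; rewrite gt_eqF.
Qed.

Lemma hA_deriv r : 0 < r < 1 -> has_deriv (@hA R) r (psi r * hA r).
Proof.
move=> r01; have n0 := num_gt0 r01; case/andP: (r01) => r0; rewrite -subr_gt0 => r1.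
have c k := has_deriv_cst k r; have i := has_deriv_id r.
have d1 := has_derivD (c 1) (has_derivN i).
have d3 := has_derivM d1 (has_derivM d1 d1).
have n3 : (1 - r) * ((1 - r) * (1 - r)) != 0 by rewrite !mulf_neq0// gt_eqF.
have -> : @hA R = fun x => num x * ((1 - x) * ((1 - x) * (1 - x)))^-1.
  by apply/funext => x; rewrite /hA -/(num x) 2!exprS expr1.
apply: has_deriv_eq (has_derivM (num_deriv r0)
  (has_derivV (f := fun x => (1 - x) * ((1 - x) * (1 - x))) n3 d3)) _.
by rewrite /= /psi /hA -/(num r); field; rewrite !gt_eqF.
Qed.

Lemma psi_deriv r : 0 < r < 1 -> has_deriv psi r (dpsi r).
Proof.
move=> r01; have n0 := num_gt0 r01; case/andP: (r01) => r0; rewrite -subr_gt0 => r1.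
have c k := has_deriv_cst k r; have i := has_deriv_id r.
have dd : has_deriv dnum r (r ^- 2 - r^-1).
  apply: has_deriv_eq (has_derivD (has_derivD (has_derivN (has_deriv_ln r0)) (c 1))
    (has_derivN (has_derivV (lt0r_neq0 r0) i))) _.
  by rewrite /=; field; rewrite gt_eqF.
have d1 := has_derivD (c 1) (has_derivN i).
have dnV := has_derivV (f := num) (lt0r_neq0 n0) (num_deriv r0).
have d1V := has_derivV (f := fun x => 1 - x) (lt0r_neq0 r1) d1.
apply: (@has_deriv_eq R psi) (has_derivD (has_derivM dd dnV) (has_derivM (c 3) d1V)) _.
by rewrite /= /dpsi; field; rewrite !gt_eqF.
Qed.

End log_derivative.

(** * Christoffel symbols on the line *)

Section connection.
Variable R : realType.
Implicit Types (p q v : 'rV[R]_6) (i j k l m n : 'I_6).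

Lemma lineE p k (h : R) n :
  (h *: ebasis R k + p) ord0 n = (n == k)%:R * h + p ord0 n.
Proof. by rewrite !mxE eqxx /= mulrC. Qed.

Lemma inord_eq (a b : nat) : (a < 6)%N -> (b < 6)%N ->
  (inord a == inord b :> 'I_6) = (a == b).
Proof. by move=> a6 b6; rewrite -(inj_eq val_inj) /= !inordK. Qed.

Lemma ord_lt2 k : (k < 2)%N -> k = inord 0 \/ k = inord 1.
Proof.
by case: k => -[|[|//]] kk _; [left|right]; apply/val_inj; rewrite /= inordK.
Qed.

Lemma rho_line p k (h : R) : (k < 2)%N ->
  rho (h *: ebasis R k + p) = rho p + 2 * p ord0 k * h + h * h.
Proof.
move=> /ord_lt2[->|->]; rewrite !rhoE !lineE !inord_eq//=; ring.
Qed.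

Lemma rho_line_deriv p k : has_deriv (fun h : R => rho p + 2 * p ord0 k * h + h * h)
  0 (2 * p ord0 k).
Proof.
have c a := has_deriv_cst a (0 : R); have i := has_deriv_id (0 : R).
apply: has_deriv_eq (has_derivD (has_derivD (c _) (has_derivM (c _) i))
  (has_derivM i i)) _.
by rewrite /=; ring.
Qed.

(** Moving in the [a] coordinates keeps [b = c = 0], and the bounds on [rho] are open conditions. *)
Lemma dilation_near p k : (k < 2)%N -> dilation p ->
  \forall h \near (0 : R), dilation (h *: ebasis R k + p).
Proof.
move=> k2 [b0 c0 r01].
pose f (h : R) := rho p + 2 * p ord0 k * h + h * h.
have cf : {for 0, continuous f} := has_deriv_continuous (rho_line_deriv p k).
have f0 : f 0 = rho p by rewrite /f !mulr0 !addr0.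
have f01 : 0 < f 0 < 1 by rewrite f0.
case/andP: f01 => fgt flt.
have ng := cvgr_gt _ cf _ fgt; have nl := cvgr_lt _ cf _ flt.
near=> h; split.
- move: b0; rewrite /cb /crd !lineE.
  by case: (ord_lt2 k2) => ->; rewrite !inord_eq//= !mul0r !add0r.
- move: c0; rewrite /cc /crd !lineE.
  by case: (ord_lt2 k2) => ->; rewrite !inord_eq//= !mul0r !add0r.
- rewrite -/(rho _) rho_line//; apply/andP; split; near: h; [exact: ng|exact: nl].
Unshelve. all: by end_near. Qed.

Lemma dg_offdiag p k i j : (k < 2)%N -> dilation p -> i != j -> dg p k i j = 0.
Proof.
move=> k2 hp /negPf ij; apply: (@derive_lineE _ _ (fun=> 0)); last exact: has_deriv_cst.
have := dilation_near k2 hp; apply: filterS => h hh.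
by rewrite gmat_dilation// ij mul0r.
Qed.

Lemma dg_diag p k i : (k < 2)%N -> (i < 2)%N -> dilation p ->
  dg p k i i = 2 * p ord0 k * psi (rho p) * gdiag p i.
Proof.
move=> k2 i2 hp; have [_ _ r01] := hp.
pose f (h : R) := rho p + 2 * p ord0 k * h + h * h.
have f0 : f 0 = rho p by rewrite /f !mulr0 !addr0.
apply: (@derive_lineE _ _ (fun h => 2 * pi * hA (f h))).
  have := dilation_near k2 hp; apply: filterS => h hh.
  by rewrite gmat_dilation// eqxx mul1r /gdiag i2 rho_line.
have dA : has_deriv (@hA R) (f 0) (psi (rho p) * hA (rho p)).
  by rewrite f0; exact: hA_deriv.
apply: has_deriv_eq (has_derivM (has_deriv_cst _ _)
  (has_deriv_comp dA (rho_line_deriv p k))) _.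
by rewrite /gdiag i2 /=; ring.
Qed.

(** The symmetry [gammaq_sym] exchanges displacements by [h] and [- h] in a [b] or [c] coordinate,
    so the coefficient is even in [h]. *)
Lemma dg_transverse p n i j : (2 <= n)%N -> (i < 2)%N -> (j < 2)%N -> dilation p ->
  dg p n i j = 0.
Proof.
move=> n2 i2 j2 [b0 c0 _]; apply: derive_even => h.
have e_dilation k : (k < 2)%N -> cb (ebasis R k) = (0, 0) /\ cc (ebasis R k) = (0, 0).
  by move=> /ord_lt2[->|->]; rewrite /cb /cc /crd /ebasis !mxE !inord_eq.
have neqn a : (a < 2)%N -> (inord a == n) = false.
  move=> a2; apply/negbTE; apply: contraTneq n2 => <-.
  by rewrite inordK -?ltnNge// (ltn_trans a2).
have sym v : cb v = (0, 0) -> cc v = (0, 0) ->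
    gammaq (- h *: ebasis R n + p) v = gammaq (h *: ebasis R n + p) v.
  move=> vb vc; apply: gammaq_sym => //.
  - by rewrite /ca /crd !lineE !neqn// !mul0r.
  - move: b0; rewrite /cneg /cb /crd !lineE /= => -[-> ->].
    by rewrite !addr0 !mulrN.
  - move: c0; rewrite /cneg /cc /crd !lineE /= => -[-> ->].
    by rewrite !addr0 !mulrN.
have [ib ic] := e_dilation i i2; have [jb jc] := e_dilation j j2.
have crdD (k : nat) : crd (ebasis R i + ebasis R j) k = crd (ebasis R i) k + crd (ebasis R j) k.
  by rewrite /crd mxE.
have ijb : cb (ebasis R i + ebasis R j) = (0, 0).
  by rewrite /cb !crdD; case: ib jb => -> -> [-> ->]; rewrite addr0.
have ijc : cc (ebasis R i + ebasis R j) = (0, 0).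
  by rewrite /cc !crdD; case: ic jc => -> -> [-> ->]; rewrite addr0.
by rewrite [LHS]mxE [RHS]mxE (sym _ ijb ijc) (sym _ ib ic) (sym _ jb jc).
Qed.

(** These are the symbols of the conformal plane metric [F |da|^2]: the gradient of [(ln F) / 2] has
    components [psi (rho p) * p ord0 j]. *)
Lemma Gam_dilation p l j k : (l < 2)%N -> (j < 2)%N -> (k < 2)%N -> dilation p ->
  Gam p l j k = psi (rho p) * ((l == k)%:R * p ord0 j + (l == j)%:R * p ord0 k
                               - (j == k)%:R * p ord0 l).
Proof.
move=> l2 j2 k2 hp; have g0 := gdiag_gt0 l hp.
have dgE (a b c : 'I_6) : (a < 2)%N -> (b < 2)%N -> (c < 2)%N ->
    dg p a b c = (b == c)%:R * (2 * p ord0 a * psi (rho p) * gdiag p l).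
  move=> a2 b2 c2; have [->|bc] := eqVneq b c; last by rewrite dg_offdiag// mul0r.
  by rewrite dg_diag// mul1r /gdiag c2 l2.
rewrite /Gam (bigD1 l)//= big1 ?addr0; last first.
  by move=> m /negPf ml; rewrite ginv_dilation// eq_sym ml !mul0r.
rewrite ginv_dilation// eqxx !dgE// mulr1n; move: (l == k)%:R (l == j)%:R (j == k)%:R => x y z.
by field; rewrite gt_eqF.
Qed.

(** The second fundamental form of the line vanishes, which is total geodesy. *)
Lemma Gam_transverse p m j k : (2 <= m)%N -> (j < 2)%N -> (k < 2)%N -> dilation p ->
  Gam p m j k = 0.
Proof.
move=> m2 j2 k2 hp.
have ne (a : 'I_6) : (a < 2)%N -> m != a.
  by move=> a2; apply: contraTneq m2 => ->; rewrite -ltnNge.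
rewrite /Gam (bigD1 m)//= big1 ?addr0; last first.
  by move=> n /negPf nm; rewrite ginv_dilation// eq_sym nm !mul0r.
rewrite (dg_transverse m2 j2 k2 hp) (dg_offdiag j2 hp (ne k k2)).
by rewrite (dg_offdiag k2 hp (ne j j2)) subr0 addr0 !mulr0.
Qed.

End connection.

(** * Curvature along the line *)

Section holomorphic_curvature.
Variable R : realType.
Implicit Types (p q v : 'rV[R]_6).

Local Notation o0 := (inord 0 : 'I_6).
Local Notation o1 := (inord 1 : 'I_6).

Lemma Riem_0011 p : dilation p -> p ord0 o1 = 0 ->
  Riem p o0 o0 o1 o1 = - 2 * (psi (rho p) + rho p * dpsi (rho p)).
Proof.
move=> hp p1; have [_ _ r01] := hp.
have l0 : ((o0 : nat) < 2)%N by rewrite inordK.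
have l1 : ((o1 : nat) < 2)%N by rewrite inordK.
have e01 : (o0 == o1) = false by rewrite inord_eq.
have e10 : (o1 == o0) = false by rewrite inord_eq.
have rE : rho p = p ord0 o0 ^+ 2 by rewrite rhoE p1 expr0n addr0.
have dpsi_line (k : 'I_6) : (k < 2)%N -> has_deriv
    (fun h : R => psi (rho p + 2 * p ord0 k * h + h * h)) 0
    (dpsi (rho p) * (2 * p ord0 k)).
  move=> k2; pose f (h : R) := rho p + 2 * p ord0 k * h + h * h.
  have f0 : f 0 = rho p by rewrite /f !mulr0 !addr0.
  have dp : has_deriv (@psi R) (f 0) (dpsi (rho p)) by rewrite f0; exact: psi_deriv.
  exact: has_deriv_comp dp (rho_line_deriv p k).
have c a := has_deriv_cst a (0 : R); have i := has_deriv_id (0 : R).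
have D0 : derive (fun q => Gam q o0 o1 o1) p (ebasis R o0) =
    - (psi (rho p) + 2 * rho p * dpsi (rho p)).
  apply: (@derive_lineE _ _ (fun h => psi (rho p + 2 * p ord0 o0 * h + h * h) *
    - (h + p ord0 o0))).
    have := dilation_near l0 hp; apply: filterS => h hh.
    by rewrite Gam_dilation// !lineE rho_line// e01 !eqxx !mul0r addr0 sub0r !mul1r.
  apply: has_deriv_eq (has_derivM (dpsi_line _ l0)
    (has_derivN (has_derivD i (c (p ord0 o0))))) _.
  by rewrite /= !mulr0 !addr0 rE; ring.
have D1 : derive (fun q => Gam q o0 o0 o1) p (ebasis R o1) = psi (rho p).
  apply: (@derive_lineE _ _ (fun h => psi (rho p + 2 * p ord0 o1 * h + h * h) * h)).
    have := dilation_near l1 hp; apply: filterS => h hh.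
    by rewrite Gam_dilation// !lineE rho_line// e01 !eqxx p1 mulr0n mulr1n; congr (_ * _); ring.
  apply: has_deriv_eq (has_derivM (dpsi_line _ l1) i) _.
  by rewrite /= !mulr0 !addr0; ring.
rewrite /Riem D0 D1 sum6.
have tail (m : 'I_6) : (2 <= m)%N ->
    Gam p o0 o0 m * Gam p m o1 o1 - Gam p o0 o1 m * Gam p m o0 o1 = 0.
  by move=> m2; rewrite !(Gam_transverse m2 _ _ hp)// !mulr0 subrr.
have ge2 a : (2 <= a)%N -> (a < 6)%N -> (2 <= (inord a : 'I_6))%N.
  by move=> a2 a6; rewrite inordK.
rewrite (tail (inord 2) (ge2 2 _ _)) // (tail (inord 3) (ge2 3 _ _)) //.
rewrite (tail (inord 4) (ge2 4 _ _)) // (tail (inord 5) (ge2 5 _ _)) // !addr0.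
(* For real [a] the quadratic terms cancel: [Gam^0_00 Gam^0_11] against [Gam^0_11 Gam^1_01], the
   symbols with an odd number of indices 1 being 0. *)
rewrite (Gam_dilation l0 l0 l0 hp) (Gam_dilation l0 l1 l1 hp)
  (Gam_dilation l0 l1 l0 hp) (Gam_dilation l0 l0 l1 hp) (Gam_dilation l1 l1 l1 hp)
  (Gam_dilation l1 l0 l1 hp) e01 e10 !eqxx p1 mulr0n mulr1n.
by ring.
Qed.

Lemma Jst_ebasis0 (s : R) : Jst (s *: ebasis R o0) = s *: ebasis R o1.
Proof.
apply/rowP => k; rewrite !mxE !eqxx /=.
case: k => -[|[|[|[|[|[|//]]]]]] kk /=; rewrite -!val_eqE /= !inordK//= ?mulr0 ?oppr0//.
Qed.

Lemma Hol_ebasis0 p (s : R) : dilation p -> p ord0 o1 = 0 ->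
  Hol p (s *: ebasis R o0) =
  s ^+ 4 * gdiag p o0 * (- 2 * (psi (rho p) + rho p * dpsi (rho p))).
Proof.
move=> hp p1; rewrite /Hol Jst_ebasis0 /Rm -Riem_0011//.
have z0 k : k != o0 -> (s *: ebasis R o0) ord0 k = 0.
  by move=> /negPf k0; rewrite !mxE eqxx /= k0 mulr0.
have z1 k : k != o1 -> (s *: ebasis R o1) ord0 k = 0.
  by move=> /negPf k0; rewrite !mxE eqxx /= k0 mulr0.
rewrite (bigD1 o0)//= [X in _ + X]big1 ?addr0; last first.
  by move=> i i0; do 4 (apply: big1 => ? _); rewrite (z0 i i0) !mul0r.
rewrite (bigD1 o1)//= [X in _ + X]big1 ?addr0; last first.
  by move=> i i0; do 3 (apply: big1 => ? _); rewrite (z1 i i0) !(mul0r, mulr0).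
rewrite (bigD1 o1)//= [X in _ + X]big1 ?addr0; last first.
  by move=> i i0; do 2 (apply: big1 => ? _); rewrite (z1 i i0) !(mul0r, mulr0).
(* The index [l] belongs to no vector; it equals [m] because the metric is diagonal, and [m] is 0
   because of the last argument. *)
rewrite (bigD1 o0)//= [X in _ + X]big1 ?addr0; last first.
  move=> i i0; apply: big1 => m _; have [->|m0] := eqVneq m o0.
    by rewrite gmat_dilation// eq_sym (negPf i0) !(mul0r, mulr0).
  by rewrite (z0 m m0) !(mul0r, mulr0).
rewrite (bigD1 o0)//= [X in _ + X]big1 ?addr0; last first.
  by move=> m m0; rewrite (z0 m m0) !(mul0r, mulr0).
rewrite gmat_dilation// eqxx mul1r !mxE !eqxx /= !mulr1.
by ring.
Qed.

Lemma gform_ebasis0 p (s : R) : dilation p ->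
  gform p (s *: ebasis R o0) (s *: ebasis R o0) = s ^+ 2 * gdiag p o0.
Proof.
move=> hp.
have z0 k : k != o0 -> (s *: ebasis R o0) ord0 k = 0.
  by move=> /negPf k0; rewrite !mxE eqxx /= k0 mulr0.
rewrite /gform (bigD1 o0)//= [X in _ + X]big1 ?addr0; last first.
  by move=> i i0; apply: big1 => ? _; rewrite (z0 i i0) !mul0r.
rewrite (bigD1 o0)//= [X in _ + X]big1 ?addr0; last first.
  by move=> i i0; rewrite (z0 i i0) mulr0.
by rewrite gmat_dilation// eqxx mul1r !mxE !eqxx /= !mulr1; ring.
Qed.

End holomorphic_curvature.

(** * Growth of the curvature as [rho] tends to 0 *)

(** The fourth power of [L / 4 <= expR (L / 4)] gives [(L / 256) * L ^+ 3 <= expR L]. *)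
Lemma expR_ge_cube (R : realType) (C L : R) : 0 <= C -> 256 * C <= L -> 0 <= L ->
  C * L ^+ 3 <= expR L.
Proof.
move=> C0 CL L0.
have h : L / 4 <= expR (L / 4).
  by apply: le_trans (expR_ge1Dx _); rewrite lerDr.
have -> : expR L = expR (L / 4) ^+ 4.
  by rewrite -expRM_natl; congr expR; field.
apply: (@le_trans _ _ ((L / 4) ^+ 4)); last by rewrite lerXn2r// ?nnegrE ?expR_ge0// divr_ge0.
have -> : (L / 4) ^+ 4 = (L / 256) * L ^+ 3 by field.
apply: ler_wpM2r; first exact: exprn_ge0.
by lra.
Qed.

Lemma curvature_bound (R : realType) (L r : R) : 1 <= L -> r = expR (- L) ->
  96 * L ^+ 3 <= expR L ->
  0 < r < 1 /\
  (expR L / 4 - 24 * L ^+ 2) / (64 * L ^+ 3) <=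
  - (psi r + r * dpsi r) / (pi * hA r).
Proof.
move=> L1 rE hL.
have L0 : 0 < L by apply: lt_le_trans L1.
have E0 := expR_gt0 L.
have r0 : 0 < r by rewrite rE expR_gt0.
have rE' : r = (expR L)^-1 by rewrite rE expRN.
have L3 : 1 <= L ^+ 3 by rewrite exprn_ege1.
have LL3 : L <= L ^+ 3 by rewrite ler_eXnr.
have rL3 : r * (96 * L ^+ 3) <= 1.
  by rewrite rE' mulrC ler_pdivrMr// mul1r.
have r96 : r <= 96^-1 by nra.
have rL : r * L <= 96^-1 by nra.
have r01 : 0 < r < 1 by rewrite r0 /=; lra.
split=> //.
have lnr : ln r = - L by rewrite rE expRK.
have n0 := num_gt0 r01; have h0 := hA_gt0 r01.
have D0 : 0 < 1 - r by lra.
have numE : num r = (1 + r) * L - 2 * (1 - r) by rewrite /num lnr opprK.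
have num2 : num r <= 2 * L by rewrite numE; nra.
(* [Q] is [- (psi r + r * dpsi r)] times [num r ^+ 2]. Its first term dominates; the other two are
   of order [L ^+ 2]. *)
pose Q := (1 - r - r * L) ^+ 2 * expR L - L * num r - 3 * num r ^+ 2 / (1 - r) ^+ 2.
have -> : - (psi r + r * dpsi r) / (pi * hA r) = Q * (1 - r) ^+ 3 / (pi * num r ^+ 3).
  rewrite /Q; have -> : expR L = r^-1 by rewrite rE' invrK.
  rewrite /psi /dpsi /dnum /hA -/(num r) lnr opprK.
  move: (@pi R) (pi_gt0 R) => P P0.
  by field; rewrite !gt_eqF.
have LL2 : L ^+ 2 <= L ^+ 3 by rewrite ler_weXn2l.
have D1 : 95 / 96 <= 1 - r by lra.
(* The square is at least 1/4, and 24 is 2 + 22, the bounds for the two subtracted terms. *)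
have Q1 : expR L / 4 - 24 * L ^+ 2 <= Q.
  have t1 : expR L / 4 <= (1 - r - r * L) ^+ 2 * expR L.
    rewrite mulrC ler_pM2r//.
    have : 1 / 2 <= 1 - r - r * L by lra.
    by move: (1 - r - r * L) => t ht; nra.
  have t2 : L * num r <= 2 * L ^+ 2 by nra.
  have t3 : 3 * num r ^+ 2 / (1 - r) ^+ 2 <= 22 * L ^+ 2.
    rewrite ler_pdivrMr ?exprn_gt0//.
    have a1 : num r ^+ 2 <= 4 * L ^+ 2 by nra.
    have a2 : 12 / 22 <= (1 - r) ^+ 2 by nra.
    have a3 : 0 <= L ^+ 2 by exact: sqr_ge0.
    by nra.
  by rewrite /Q; lra.
have E96 : 0 <= expR L / 4 - 24 * L ^+ 2 by lra.
have pn0 : 0 < pi * num r ^+ 3 by rewrite mulr_gt0 ?pi_gt0// exprn_gt0.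
(* The 64 combines [pi * num r ^+ 3 <= 32 * L ^+ 3] with [1 / 2 <= (1 - r) ^+ 3]. *)
rewrite ler_pdivrMr ?mulr_gt0 ?exprn_gt0// mulrAC ler_pdivlMr//.
have b1 : 1 / 2 <= (1 - r) ^+ 3.
  apply: (@le_trans _ _ ((95 / 96) ^+ 3)); first lra.
  by rewrite lerXn2r// nnegrE; lra.
have b2 : pi * num r ^+ 3 <= 32 * L ^+ 3.
  have -> : 32 * L ^+ 3 = 4 * (2 * L) ^+ 3 by ring.
  apply: ler_pM; [exact: pi_ge0|by rewrite exprn_ge0// ltW|by have := @pihalf_lt2 R; lra|].
  by rewrite lerXn2r// nnegrE ?mulr_ge0// ltW.
apply: (@le_trans _ _ ((expR L / 4 - 24 * L ^+ 2) * (32 * L ^+ 3))).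
  exact: ler_wpM2l.
have -> : Q * (1 - r) ^+ 3 * (64 * L ^+ 3) = Q * (2 * (1 - r) ^+ 3 * (32 * L ^+ 3)).
  by ring.
apply: ler_pM => //; first by rewrite mulr_ge0// exprn_ge0// ltW.
by rewrite ler_peMl ?mulr_ge0 ?exprn_ge0 ?(ltW L0)//; lra.
Qed.

Theorem theorem4p1 (R : realType) (K : R) :
  exists (p X : 'rV[R]_6),
    inM1 p /\ gform p X X = 1 /\ K < Hol p X.
Proof.
(* In [C], 96 pays for the hypothesis of [curvature_bound] and the loss [24 * L ^+ 2], while
   [256 = 4 * 64] leaves a curvature of at least [|K| + 1]. [L] meets the threshold of
   [expR_ge_cube]. The point is [W(z) = sqrt(r) z]. *)
pose C := 96 + 256 * (`|K| + 1); pose L := 256 * C + 1; pose r := expR (- L).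
have K0 : 0 <= `|K| by [].
have C96 : 96 <= C by rewrite /C; lra.
have L1 : 1 <= L by rewrite /L; lra.
have Lp : 0 < L by lra.
have L0 := ltW Lp.
have CE : C * L ^+ 3 <= expR L by apply: expR_ge_cube => //; rewrite /L; lra.
have L3 : 0 < L ^+ 3 by rewrite exprn_gt0//; lra.
have [] := @curvature_bound R L r L1 erefl; first by apply: le_trans CE; rewrite ler_pM2r.
move=> r01 bound.
pose p : 'rV[R]_6 := Num.sqrt r *: ebasis R (inord 0).
have pE k : p ord0 k = (k == inord 0)%:R * Num.sqrt r by rewrite !mxE eqxx mulrC.
have p1 : p ord0 (inord 1) = 0 by rewrite pE inord_eq// mul0r.
have rp : rho p = r.
  by rewrite rhoE p1 pE eqxx mul1r expr0n addr0 sqr_sqrtr// ltW//; case/andP: r01.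
have hp : dilation p.
  split; last by rewrite -/(rho p) rp.
  - by rewrite /cb /crd !pE !inord_eq// !mul0r.
  - by rewrite /cc /crd !pE !inord_eq// !mul0r.
have g0 := gdiag_gt0 (inord 0) hp.
pose s := (Num.sqrt (gdiag p (inord 0)))^-1.
have s2 : s ^+ 2 = (gdiag p (inord 0))^-1 by rewrite exprVn sqr_sqrtr// ltW.
exists p, (s *: ebasis R (inord 0)); split; [|split].
- case: hp => b0 c0 a01; rewrite /inM1 b0 c0 => ca0; move: a01.
  have -> : ca p = (0, 0).
    by move: ca0; rewrite /csub /cmul /= !mul0r subr0 addr0 !subr0.
  by rewrite /cabs2 /= expr0n addr0 ltxx.
- by rewrite gform_ebasis0// s2 mulVf// gt_eqF.
- rewrite Hol_ebasis0// rp.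
  (* Normalization makes [s ^+ 4] the inverse square of the coefficient [2 * pi * hA r], so one
     factor survives and absorbs the 2. *)
  have -> : s ^+ 4 * gdiag p (inord 0) * (-2 * (psi r + r * dpsi r)) =
      - (psi r + r * dpsi r) / (pi * hA r).
    have -> : s ^+ 4 = s ^+ 2 * s ^+ 2 by rewrite -exprD.
    rewrite s2 /gdiag inordK//= rp.
    move: (@pi R) (pi_gt0 R) => P P0.
    by field; rewrite !gt_eqF ?hA_gt0.
  apply: lt_le_trans bound; rewrite ltr_pdivlMr ?mulr_gt0//.
  have LL2 : L ^+ 2 <= L ^+ 3 by rewrite ler_weXn2l.
  have KK : K * (64 * L ^+ 3) <= `|K| * (64 * L ^+ 3).
    by rewrite ler_wpM2r ?ler_norm// mulr_ge0// ltW.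
  have : (96 + 256 * (`|K| + 1)) * L ^+ 3 <= expR L by [].
  by lra.
Qed.
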